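(* Let $d\ge 3$ and let $\beta\in\mathbb{R}$. Then the maps $\sqrt{2}\,\mathbf{T}_+$ and $\sqrt{2}\,\mathbf{T}_-$ (the radiation profile maps $(u_0,u_1)\mapsto \sqrt2\,G_\pm$) are isometries from $\dot H^{\beta}(\mathbb{R}^d)\times \dot H^{\beta-1}(\mathbb{R}^d)$ to $L^2(\mathbb{S}^{d-1};\dot H^{\beta-1}(\mathbb{R}))$.
   Context: Fourier transforms: $\hat u(\xi)=\int_{\mathbb{R}^d}e^{i\xi\cdot x}u(x)\,dx$ on $\mathbb{R}^d$, and for $G=G(s,\omega)$ on $\mathbb{R}\times\mathbb{S}^{d-1}$ the partial Fourier transform $(\mathcal{F}G)(\nu,\omega)=\int_{\mathbb{R}}e^{i\nu s}G(s,\omega)\,ds$. Radiation profile maps: $\mathbf{T}_\pm(u_0,u_1)=G_\pm$, where, with $c_d=\frac{1}{2(2\pi)^{(d-1)/2}}$, $\tau=\frac{d-1}{4}\pi$, and $\chi_+$, $\chi_-$ the characteristic functions of $(0,\infty)$ and $(-\infty,0)$, $$\mathcal{F}G_+(\nu,\omega)=-c_d|\nu|^{\frac{d-1}{2}}\left[e^{i\tau}\chi_-(\nu)+e^{-i\tau}\chi_+(\nu)\right]\left(i\nu\hat u_0(\nu\omega)-\hat u_1(\nu\omega)\right),$$ $$\mathcal{F}G_-(\nu,\omega)=+c_d|\nu|^{\frac{d-1}{2}}\left[e^{i\tau}\chi_-(\nu)+e^{-i\tau}\chi_+(\nu)\right]\left(i\nu\hat u_0(\nu\omega)+\hat u_1(\nu\omega)\right).$$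 Norms: $\|f\|_{\dot H^{\alpha}(\mathbb{R}^n)}^2=(2\pi)^{-n}\int_{\mathbb{R}^n}|\xi|^{2\alpha}|\hat f(\xi)|^2\,d\xi$; $\|(u_0,u_1)\|^2_{\dot H^\beta\times\dot H^{\beta-1}}=\|u_0\|^2_{\dot H^\beta}+\|u_1\|^2_{\dot H^{\beta-1}}$; and $\|G\|^2_{L^2(\mathbb{S}^{d-1};\dot H^{\alpha}(\mathbb{R}))}=\int_{\mathbb{S}^{d-1}}\|G(\cdot,\omega)\|^2_{\dot H^\alpha(\mathbb{R})}\,d\omega$. The spaces are the Hilbert spaces determined by these norms (elements identified with their Fourier transforms in the corresponding weighted $L^2$ space). *)

(* Defs.v *)
From HB Require Import structures.
From mathcomp Require Import all_boot all_order all_algebra.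
From mathcomp Require Import all_classical all_reals all_analysis.
From mathcomp Require Import measurable_realfun.
From mathcomp.real_closed Require Import complex.
Set Implicit Arguments.
Unset Strict Implicit.
Unset Printing Implicit Defensive.
Import Order.TTheory GRing.Theory Num.Theory.
Import numFieldNormedType.Exports.
Local Open Scope classical_set_scope.
Local Open Scope ring_scope.
Local Open Scope complex_scope.

(* The library's norm on 'rV[R]_d is the sup norm and 'rV[R]_d carries no
   sigma-algebra, so R^d is the type of d-tuples with its product
   sigma-algebra (i.e. the Borel sets of R^d). *)
Notation Rvec R d := (d.-tuple (measurableTypeR R)).

Section lebesgue_measure_Rn.
Context (R : realType).

Definition tcons n (p : measurableTypeR R * Rvec R n) : Rvec R n.+1 :=
  [tuple of p.1 :: p.2].

Lemma measurable_tcons n : measurable_fun [set: _] (@tcons n).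
Proof. exact: (measurable_cons measurable_fst measurable_snd). Qed.

Section step.
Context n (mu : {sigma_finite_measure set (Rvec R n) -> \bar R}).

Definition lebesgue_step : set (Rvec R n.+1) -> \bar R :=
  pushforward (lebesgue_measure \x mu)%E (@tcons n).

Let lebesgue_step0 : lebesgue_step set0 = 0%E.
Proof. by rewrite /lebesgue_step /pushforward preimage_set0 measure0. Qed.

Let lebesgue_step_ge0 A : (0 <= lebesgue_step A)%E.
Proof. by rewrite /lebesgue_step /pushforward; exact: measure_ge0. Qed.

Let lebesgue_step_sigma_additive : semi_sigma_additive lebesgue_step.
Proof.
move=> F mF tF mUF; rewrite /lebesgue_step /pushforward preimage_bigcup.
have mcons A : measurable A -> measurable (@tcons n @^-1` A).
  by move=> mA; rewrite -[X in measurable X]setTI; exact: measurable_tcons.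
apply: measure_semi_sigma_additive.
- by move=> i; exact: mcons.
- apply/trivIsetP => /= i j _ _ ij; rewrite -preimage_setI.
  by move/trivIsetP : tF => /(_ _ _ _ _ ij) ->//; rewrite preimage_set0.
- by rewrite -preimage_bigcup; exact: mcons.
Qed.

HB.instance Definition _ := isMeasure.Build _ _ _ lebesgue_step
  lebesgue_step0 lebesgue_step_ge0 lebesgue_step_sigma_additive.

Let lebesgue_step_sigma_finite : sigma_finite setT lebesgue_step.
Proof.
have /sigma_finiteP[F [TF ndF Foo]] := sigma_finiteT (@lebesgue_measure R).
have /sigma_finiteP[G [TG ndG Goo]] := sigma_finiteT mu.
exists (fun k => [set t : Rvec R n.+1 | F k (thead t) /\ G k [tuple of behead t]]).
  apply/seteqP; split => // t _.
  have [i _ Fi] : (\bigcup_i F i) (thead t) by rewrite -TF.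
  have [j _ Gj] : (\bigcup_i G i) [tuple of behead t] by rewrite -TG.
  exists (maxn i j) => //; split.
    by have /subsetPset := ndF _ _ (leq_maxl i j); apply.
  by have /subsetPset := ndG _ _ (leq_maxr i j); apply.
move=> k; have [mF Fk] := Foo k; have [mG Gk] := Goo k; split.
  have m1 : measurable_fun [set: Rvec R n.+1] (@thead n _).
    exact: measurable_tnth.
  have m2 : measurable_fun [set: Rvec R n.+1]
      (fun t => [tuple of behead t] : Rvec R n) by exact: measurable_behead.
  apply: measurableI.
    by rewrite -[X in measurable X]setTI; exact: m1.
  by rewrite -[X in measurable X]setTI; exact: m2.
rewrite /lebesgue_step /pushforward.
rewrite (_ : _ @^-1` _ = F k `*` G k).
  rewrite product_measure1E// lte_mul_pinfty//.
  by rewrite ge0_fin_numE.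
apply/seteqP; split => -[x t] /=.
  rewrite theadE; case=> Fx; rewrite (_ : [tuple of _] = t) //.
  exact/val_inj.
move=> [Fx Gt]; rewrite theadE; split => //.
by rewrite (_ : [tuple of _] = t) //; exact/val_inj.
Qed.

HB.instance Definition _ := Measure_isSigmaFinite.Build _ _ _
  lebesgue_step lebesgue_step_sigma_finite.

End step.

Fixpoint lebesgue_measure_Rn n :
    {sigma_finite_measure set (Rvec R n) -> \bar R} :=
  match n return {sigma_finite_measure set (Rvec R n) -> \bar R} with
  | 0 => [the {sigma_finite_measure set _ -> \bar R} of
           @dirac _ (Rvec R 0) [tuple] R]
  | m.+1 => [the {sigma_finite_measure set _ -> \bar R} of
              lebesgue_step (lebesgue_measure_Rn m)]
  end.

End lebesgue_measure_Rn.

Section sphere.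
Context (R : realType) (d : nat).

Definition eucl_norm (x : Rvec R d) : R :=
  Num.sqrt (\sum_(i < d) tnth x i ^+ 2).

Definition scalev (a : R) (x : Rvec R d) : Rvec R d :=
  [tuple a * tnth x i | i < d].

Definition sphere : set (Rvec R d) := [set x | eucl_norm x = 1].

Definition cone (A : set (Rvec R d)) : set (Rvec R d) :=
  [set x | 0 < eucl_norm x <= 1 /\ A (scalev (eucl_norm x)^-1 x)].

(* The surface measure of the unit sphere, sigma(A) = d |{r w : 0 < r <= 1,
   w in A}|, seen as a Borel measure on R^d carried by the sphere. *)
Definition sphere_measure (A : set (Rvec R d)) : \bar R :=
  (d%:R%:E * lebesgue_measure_Rn R d (cone A))%E.

Lemma measurable_eucl_norm : measurable_fun [set: Rvec R d] eucl_norm.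
Proof.
apply: (measurableT_comp (f := @Num.sqrt R)).
  exact: continuous_measurable_fun (@sqrt_continuous R).
apply: measurable_sum => i; apply: measurable_funX; exact: measurable_tnth.
Qed.

Lemma measurable_cone A : measurable A -> measurable (cone A).
Proof.
move=> mA.
rewrite (_ : cone A = [set x | 0 < eucl_norm x <= 1] `&`
  (fun x => scalev (eucl_norm x `^ (-1)) x) @^-1` A); last first.
  apply/seteqP; split => x /=.
    by move=> [? ?]; rewrite powR_inv1 ?sqrtr_ge0.
  by move=> [? ?]; rewrite /cone/= -powR_inv1 ?sqrtr_ge0.
apply: measurableI.
  rewrite (_ : [set _ | _] = eucl_norm @^-1` `]0, 1]); last first.
    by apply/seteqP; split => x /=; rewrite in_itv.
  by rewrite -[X in measurable X]setTI; exact: measurable_eucl_norm.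
rewrite -[X in measurable X]setTI.
suff : measurable_fun [set: Rvec R d]
    (fun x => scalev (eucl_norm x `^ (-1)) x) by exact.
apply/measurable_fun_tnthP => i.
rewrite (_ : _ \o _ = fun x => eucl_norm x `^ (-1) * tnth x i); last first.
  by apply/funext => x /=; rewrite tnth_mktuple.
apply: measurable_funM; last exact: measurable_tnth.
apply: (measurableT_comp (f := @powR R ^~ (-1))).
  exact: measurable_powR.
exact: measurable_eucl_norm.
Qed.

Let sphere_measure0 : sphere_measure set0 = 0%E.
Proof.
rewrite /sphere_measure (_ : cone set0 = set0) ?measure0 ?mule0//.
by apply/seteqP; split => x // -[].
Qed.

Let sphere_measure_ge0 A : (0 <= sphere_measure A)%E.
Proof. by rewrite mule_ge0 ?lee_fin. Qed.

Let sphere_measure_sigma_additive : semi_sigma_additive sphere_measure.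
Proof.
move=> F mF tF mUF.
have coneU : cone (\bigcup_n F n) = \bigcup_n cone (F n).
  apply/seteqP; split => x.
    by move=> [x1 [n _ Fx]]; exists n.
  by move=> [n _ [x1 Fx]]; split => //; exists n.
have := @measure_semi_sigma_additive _ _ _
  (mscale (d%:R)%:nng (lebesgue_measure_Rn R d)) (cone \o F).
rewrite -coneU; apply.
- by move=> n; exact: measurable_cone.
- apply/trivIsetP => i j _ _ ij; apply/seteqP; split => // x [[_ Fi] [_ Fj]].
  have : (F i `&` F j) (scalev (eucl_norm x)^-1 x) by [].
  by move/trivIsetP : tF => /(_ _ _ I I ij) ->.
- exact: measurable_cone.
Qed.

HB.instance Definition _ := isMeasure.Build _ _ _ sphere_measure
  sphere_measure0 sphere_measure_ge0 sphere_measure_sigma_additive.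

End sphere.
Arguments eucl_norm {R d}.
Arguments sphere_measure R d : clear implicits.
Arguments sphere R d : clear implicits.

Section complex_functions.
Context (R : realType).

Definition cmeasurable_fun dT (T : measurableType dT) (D : set T)
    (f : T -> R[i]) : Prop :=
  measurable_fun D (fun x => complex.Re (f x)) /\ measurable_fun D (fun x => complex.Im (f x)).

Definition sqmod (z : R[i]) : R := complex.Re z ^+ 2 + complex.Im z ^+ 2.

Definition cis (t : R) : R[i] := cos t +i* sin t.

End complex_functions.

(* From here on an element of a space is given by its
   Fourier transform: the arguments of the norms and of the maps are the functions
   \hat u on R^d, \hat f on R and (nu, w) |-> (F G)(nu, w) on R * S^(d-1).
   At the origin x `^ p with p < 0 takes the value 0 rather than +oo, on a
   null set. *)

Section homogeneous_sobolev.
Context (R : realType).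

Definition hdot_sqnorm d (alpha : R) (f : Rvec R d -> R[i]) : \bar R :=
  (((2 * pi) ^- d)%:E * \int[lebesgue_measure_Rn R d]_xi
     (eucl_norm xi `^ (2 * alpha) * sqmod (f xi))%:E)%E.

Definition in_hdot d (alpha : R) (f : Rvec R d -> R[i]) : Prop :=
  cmeasurable_fun setT f /\ (hdot_sqnorm alpha f < +oo)%E.

Definition hdot1_sqnorm (alpha : R) (f : measurableTypeR R -> R[i]) : \bar R :=
  (((2 * pi)^-1)%:E * \int[lebesgue_measure]_nu
     (`|nu| `^ (2 * alpha) * sqmod (f nu))%:E)%E.

End homogeneous_sobolev.

Section initial_data.
Context (R : realType) (d : nat).

(* (\hat u_0, \hat u_1) *)
Definition data : Type := ((Rvec R d -> R[i]) * (Rvec R d -> R[i]))%type.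

Definition in_data (beta : R) (u : data) : Prop :=
  in_hdot beta u.1 /\ in_hdot (beta - 1) u.2.

Definition data_norm (beta : R) (u : data) : R :=
  Num.sqrt (fine (hdot_sqnorm beta u.1 + hdot_sqnorm (beta - 1) u.2)%E).

Definition data_eq (u v : data) : Prop :=
  {ae lebesgue_measure_Rn R d, forall xi, u.1 xi = v.1 xi} /\
  {ae lebesgue_measure_Rn R d, forall xi, u.2 xi = v.2 xi}.

Definition data_lin (a : R[i]) (u v : data) : data :=
  (fun xi => a * u.1 xi + v.1 xi, fun xi => a * u.2 xi + v.2 xi).

End initial_data.

Section radiation_profiles.
Context (R : realType) (d : nat).

(* F G; only its values on R * S^(d-1) matter. *)
Definition profile : Type := measurableTypeR R * Rvec R d -> R[i].

Definition profile_sqnorm (alpha : R) (G : profile) : \bar R :=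
  (\int[sphere_measure R d]_(w in sphere R d)
     hdot1_sqnorm alpha (fun nu => G (nu, w)))%E.

Definition in_profile (alpha : R) (G : profile) : Prop :=
  cmeasurable_fun (setT `*` sphere R d) G /\ (profile_sqnorm alpha G < +oo)%E.

Definition profile_norm (alpha : R) (G : profile) : R :=
  Num.sqrt (fine (profile_sqnorm alpha G)).

Definition profile_eq (G H : profile) : Prop :=
  {ae sphere_measure R d, forall w, sphere R d w ->
    {ae lebesgue_measure, forall nu, G (nu, w) = H (nu, w)}}.

End radiation_profiles.

Section radiation_maps.
Context (R : realType) (d : nat).

Definition c_d : R := 1 / (2 * (2 * pi) `^ ((d%:R - 1) / 2)).

Definition tau : R := (d%:R - 1) / 4 * pi.

Definition phase (nu : R) : R[i] :=
  cis tau * (nu < 0)%R%:R + cis (- tau) * (0 < nu)%R%:R.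

Definition Tplus (u : data R d) : profile R d := fun p =>
  let: (nu, w) := p in
  - (c_d * `|nu| `^ ((d%:R - 1) / 2))%:C * phase nu *
  ((0 +i* nu) * u.1 (scalev nu w) - u.2 (scalev nu w)).

Definition Tminus (u : data R d) : profile R d := fun p =>
  let: (nu, w) := p in
  (c_d * `|nu| `^ ((d%:R - 1) / 2))%:C * phase nu *
  ((0 +i* nu) * u.1 (scalev nu w) + u.2 (scalev nu w)).

(* T, given on representatives, induces a linear isometry between the spaces
   of almost everywhere classes. *)
Definition is_isometry (beta : R) (T : data R d -> profile R d) : Prop :=
  [/\ forall u, in_data beta u -> in_profile (beta - 1) (T u),
      forall u v, in_data beta u -> in_data beta v -> data_eq u v ->
        profile_eq (T u) (T v),
      forall a u v, in_data beta u -> in_data beta v ->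
        profile_eq (T (data_lin a u v)) (fun p => a * T u p + T v p) &
      forall u, in_data beta u ->
        profile_norm (beta - 1) (T u) = data_norm beta u].

End radiation_maps.

(* Main.v *)
Require Import Defs.
From HB Require Import structures.
From mathcomp Require Import all_boot all_order all_algebra.
From mathcomp Require Import all_classical all_reals all_analysis.
From mathcomp Require Import measurable_realfun.
From mathcomp.real_closed Require Import complex.
From mathcomp Require Import ring.
Set Implicit Arguments.
Unset Strict Implicit.
Unset Printing Implicit Defensive.
Import Order.TTheory GRing.Theory Num.Theory.
Import numFieldNormedType.Exports.
Local Open Scope classical_set_scope.
Local Open Scope ring_scope.
Local Open Scope complex_scope.

(* Polar coordinates xi = nu w with nu > 0, and again with nu < 0, turn the
   norm of G into an integral over R^d: the two half-lines contribute
   |i|xi| u_0 + u_1|^2 and |-i|xi| u_0 + u_1|^2 (hatted functions at xi), whose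
   sum is 2 (|xi|^2 |u_0|^2 + |u_1|^2) by the parallelogram identity.  The
   factor |nu|^(d-1) from the multiplier is the Jacobian, and the phase has
   modulus 1.  The same formula applied to the indicator of a null set shows
   that the maps respect almost everywhere equality. *)

(** * Dilations and Lebesgue measure on the line and on [Rvec R d] *)

Section scaling.
Context (R : realType).
Implicit Types a : R.

(** Inversion is not continuous at 0, so it is reduced to a real power: x^-1 = x (|x|^-1)^2, where
    both sides are 0 at x = 0. *)
Lemma measurable_invr :
  measurable_fun setT (fun x : measurableTypeR R => x^-1 : measurableTypeR R).
Proof.
have -> : (fun x : R => x^-1) = (fun x => x * (`|x| `^ (-1)) ^+ 2).
  apply/funext => x; rewrite powR_inv1// exprVn real_normK ?num_real//.
  have [->|x0] := eqVneq x 0; first by rewrite invr0 mul0r.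
  by rewrite expr2 invfM mulrA mulfV// mul1r.
apply: measurable_funM => //; apply: measurable_funX.
by apply: (measurableT_comp (f := @powR R ^~ (-1))); [exact: measurable_powR|].
Qed.

(** By uniqueness of Lebesgue measure it suffices to compare both sides on half-open intervals. *)
Lemma lebesgue_measure_scale a (A : set (measurableTypeR R)) : a != 0 ->
  measurable A ->
  (lebesgue_measure A = `|a|%:E * pushforward lebesgue_measure
    ( *%R a : measurableTypeR R -> measurableTypeR R) A)%E.
Proof.
move=> a0 mA.
have ma : measurable_fun setT ( *%R a : measurableTypeR R -> measurableTypeR R).
  exact: mulrl_measurable.
pose f : {mfun measurableTypeR R >-> measurableTypeR R} :=
  HB.pack ( *%R a : measurableTypeR R -> measurableTypeR R)
    (isMeasurableFun.Build _ _ _ _ _ ma).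
apply: (@lebesgue_measure_unique _
  (mscale `|a|%:nng (pushforward lebesgue_measure f))) => //.
move=> _ [[x y] _ <-] /=; rewrite /mscale/= /pushforward lebesgue_measure_itv/= lte_fin.
have [a_lt0|a_gt0|/eqP] := ltgtP a 0; last by rewrite (negbTE a0).
(* A negative factor reverses the order, so the closed end of the interval changes sides; the length
   is unaffected. *)
- rewrite (_ : _ @^-1` _ = `[y / a, x / a[%classic); last first.
    apply/seteqP; split => z /=; rewrite !in_itv/= ler_ndivrMr// ltr_ndivlMr//;
    by rewrite [z * a]mulrC andbC.
  rewrite lebesgue_measure_itv/= lte_fin ltr_nM2r ?invr_lt0//.
  case: ifPn => _; last by rewrite mule0.
  rewrite -!EFinB -EFinM ltr0_norm//; congr EFin.
  by field.
- rewrite (_ : _ @^-1` _ = `]x / a, y / a]%classic); last first.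
    apply/seteqP; split => z /=; rewrite !in_itv/= ler_pdivlMr// ltr_pdivrMr//;
    by rewrite [z * a]mulrC.
  rewrite lebesgue_measure_itv/= lte_fin ltr_pM2r ?invr_gt0//.
  case: ifPn => _; last by rewrite mule0.
  rewrite -!EFinB -EFinM gtr0_norm//; congr EFin.
  by field.
Qed.

Lemma ge0_integral_scale a (f : measurableTypeR R -> \bar R) : a != 0 ->
  measurable_fun setT f -> (forall x, 0 <= f x)%E ->
  (\int[lebesgue_measure]_x f (a * x)%R = `|a|^-1%:E * \int[lebesgue_measure]_x f x)%E.
Proof.
move=> a0 mf f0.
have ma : measurable_fun setT ( *%R a : measurableTypeR R -> measurableTypeR R).
  exact: mulrl_measurable.
pose g : {mfun measurableTypeR R >-> measurableTypeR R} :=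
  HB.pack ( *%R a : measurableTypeR R -> measurableTypeR R)
    (isMeasurableFun.Build _ _ _ _ _ ma).
rewrite [in RHS](@eq_measure_integral _ _ _ _
  (mscale `|a|%:nng (pushforward lebesgue_measure g)) lebesgue_measure); last first.
  by move=> A mA _; exact: lebesgue_measure_scale.
rewrite ge0_integral_mscale//= muleA -EFinM mulVf ?normr_eq0// mul1e.
by rewrite ge0_integral_pushforward// => x _; exact: f0.
Qed.

(** A dilation acts separately on the first coordinate and on the rest, which is what allows
    induction on the dimension. *)
Lemma scalev_cons a n (p : measurableTypeR R * Rvec R n) :
  scalev a (tcons p) = tcons (a * p.1, scalev a p.2).
Proof.
apply: eq_from_tnth => i; rewrite tnth_mktuple /tcons.
case: (unliftP ord0 i) => [j|] ->; rewrite ?tnth0//.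
by rewrite !tnthS tnth_mktuple.
Qed.

Lemma measurable_scalev d : measurable_fun setT
  (fun p : measurableTypeR R * Rvec R d => scalev p.1 p.2).
Proof.
apply/measurable_fun_tnthP => i.
rewrite (_ : _ \o _ =
  fun p : measurableTypeR R * Rvec R d => p.1 * tnth p.2 i); last first.
  by apply/funext => x /=; rewrite tnth_mktuple.
apply: measurable_funM => //.
exact: (measurableT_comp (measurable_tnth i)).
Qed.

Lemma measurable_scalevr d a : measurable_fun setT (@scalev R d a).
Proof. by move: (measurable_fun_pair2 a (@measurable_scalev d)). Qed.

(** Induction on the dimension: the section at x of the preimage is the preimage of the section at a
    x. The induction hypothesis gives |a|^-d, and the substitution in the first coordinate gives one
    more factor |a|^-1. *)
Lemma lebesgue_measure_Rn_scale d a (A : set (Rvec R d)) : a != 0 ->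
  measurable A ->
  (lebesgue_measure_Rn R d (scalev a @^-1` A) =
   (`|a| ^- d)%:E * lebesgue_measure_Rn R d A)%E.
Proof.
move=> a0; elim: d A => [|d IH] A mA.
  rewrite expr0 invr1 mul1e /= (_ : _ @^-1` _ = A)//.
  by apply/seteqP; split => x /=; rewrite (tuple0 (scalev a x)) (tuple0 x).
have mtA : measurable (@tcons R d @^-1` A).
  by rewrite -[X in measurable X]setTI; exact: measurable_tcons.
rewrite /= /lebesgue_step /pushforward /product_measure1.
pose h x := lebesgue_measure_Rn R d (xsection (@tcons R d @^-1` A) x).
have mh : measurable_fun setT h by exact: measurable_fun_xsection.
transitivity (\int[lebesgue_measure]_x ((`|a| ^- d)%:E * h (a * x)%R))%E.
  apply: eq_integral => x _ /=; rewrite -IH; last exact: measurable_xsection.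
  congr (lebesgue_measure_Rn R d _); apply/seteqP; split => y;
  by rewrite /xsection /= !inE /= scalev_cons.
rewrite ge0_integralZl//; last first.
  by apply: measurableT_comp mh _; exact: mulrl_measurable.
rewrite ge0_integral_scale// muleA -EFinM -invfM -exprSr//.
Qed.

Lemma ge0_integral_Rn_scale d a (f : Rvec R d -> \bar R) : a != 0 ->
  measurable_fun setT f -> (forall x, 0 <= f x)%E ->
  (\int[lebesgue_measure_Rn R d]_x f (scalev a x) =
   (`|a| ^- d)%:E * \int[lebesgue_measure_Rn R d]_x f x)%E.
Proof.
move=> a0 mf f0.
pose g : {mfun Rvec R d >-> Rvec R d} :=
  HB.pack (@scalev R d a) (isMeasurableFun.Build _ _ _ _ _ (measurable_scalevr a)).
transitivity (\int[pushforward (lebesgue_measure_Rn R d) g]_x f x)%E.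
  by rewrite ge0_integral_pushforward// => x _; exact: f0.
have c0 : 0 <= `|a| ^- d by rewrite invr_ge0 exprn_ge0.
rewrite (@eq_measure_integral _ _ _ _
  (mscale (NngNum c0) (lebesgue_measure_Rn R d))
  (pushforward (lebesgue_measure_Rn R d) g)).
  by rewrite ge0_integral_mscale.
by move=> A mA _; exact: lebesgue_measure_Rn_scale.
Qed.

Lemma eucl_norm_scalev d a (x : Rvec R d) :
  eucl_norm (scalev a x) = `|a| * eucl_norm x.
Proof.
rewrite /eucl_norm -sqrtr_sqr -sqrtrM ?sqr_ge0// mulr_sumr; congr Num.sqrt.
by apply: eq_bigr => i _; rewrite tnth_mktuple exprMn.
Qed.

Lemma scalevA d a b (x : Rvec R d) : scalev a (scalev b x) = scalev (a * b) x.
Proof. by apply: eq_from_tnth => i; rewrite !tnth_mktuple mulrA. Qed.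

Lemma eucl_norm_ge0 d (x : Rvec R d) : 0 <= eucl_norm x.
Proof. exact: sqrtr_ge0. Qed.

Lemma eucl_norm_eq0 d (x : Rvec R d) i : eucl_norm x = 0 -> tnth x i = 0.
Proof.
move/eqP; rewrite sqrtr_eq0 => sx; apply/eqP; rewrite -sqrf_eq0.
have s0 : \sum_(i < d) tnth x i ^+ 2 == 0.
  by rewrite eq_le sx sumr_ge0// => j _; rewrite sqr_ge0.
move: s0; rewrite psumr_eq0 => [/allP/(_ i)|j _]; last exact: sqr_ge0.
by apply; rewrite mem_index_enum.
Qed.

(** The origin lies in the hyperplane where the first coordinate is 0, which is null as a product
    with {0}. The dimension must be positive: in dimension 0 the measure is a Dirac mass. This lets
    later identities be checked away from the origin only. *)
Lemma lebesgue_measure_Rn_norm0 n :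
  lebesgue_measure_Rn R n.+1 [set x | eucl_norm x = 0] = 0%E.
Proof.
have mS : measurable [set x : Rvec R n.+1 | eucl_norm x = 0].
  rewrite (_ : [set _ | _] = eucl_norm @^-1` [set 0])//.
  by rewrite -[X in measurable X]setTI; exact: measurable_eucl_norm.
have m1 : measurable_fun setT (fun t : Rvec R n.+1 => tnth t ord0).
  exact: measurable_tnth.
have mT : measurable [set x : Rvec R n.+1 | tnth x ord0 = 0].
  by rewrite -[X in measurable X]setTI; exact: (m1 measurableT [set 0]).
apply: (@subset_measure0 _ _ _ _ _ [set x : Rvec R n.+1 | tnth x ord0 = 0]) => //.
  by move=> x /= /eucl_norm_eq0.
rewrite /= /lebesgue_step /pushforward (_ : _ @^-1` _ = [set 0] `*` setT).
  rewrite product_measure1E// -[X in (X * _)%E]/(lebesgue_measure [set 0]).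
  by rewrite lebesgue_measure_set1 mul0e.
by apply/seteqP; split => -[x y] /=; rewrite tnth0// => -[].
Qed.

End scaling.

(** * Integrals of negative powers over a half-line *)

Section radial_integrals.
Context (R : realType).

Lemma measurable_fun_invX d (T : measurableType d) (f : T -> R) n :
  measurable_fun setT f -> measurable_fun setT (fun x => (f x)^-1 ^+ n).
Proof.
move=> mf; apply: measurable_funX.
exact: (measurableT_comp (@measurable_invr R)).
Qed.

Lemma measurable_fun_natb d (T : measurableType d) (b : T -> bool) :
  measurable_fun setT b -> measurable_fun setT (fun x => (b x)%:R : R).
Proof.
move=> mb; rewrite (_ : (fun _ => _) = (fun x => if b x then 1 else 0)).
  exact: measurable_fun_ifT.
by apply/funext => x; case: (b x).
Qed.

(** The function [F], equal to -s^-(n+1), is a primitive that tends to 0 at infinity. *)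
Lemma integral_exprV_itvcy n (r : R) : 0 < r ->
  (\int[lebesgue_measure]_(s in `[r, +oo[) (n.+1%:R * s^-1 ^+ n.+2)%:E =
   (r^-1 ^+ n.+1)%:E)%E.
Proof.
move=> r0; pose F (x : R) := - x^-1 ^+ n.+1.
have dF (x : R) : 0 < x -> is_derive x 1 F (n.+1%:R * x^-1 ^+ n.+2).
  move=> x0; have x_neq0 : x != 0 by rewrite gt_eqF.
  rewrite (_ : F = - ((@GRing.inv R) ^+ n.+1)); last first.
    by apply/funext => y; rewrite /F !fctE.
  apply: is_derive_eq.
    apply: is_deriveN; apply: is_deriveX.
    exact: (@is_deriveV _ id).
  by rewrite /GRing.scale/= mulr1 mulrN opprK -mulrA -exprVn -exprD addn2.
rewrite (@ge0_continuous_FTC2y _ _ F r 0)//.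
- by rewrite sub0e /F -EFinN opprK.
- move=> x rx; rewrite mulr_ge0// exprn_ge0// invr_ge0.
  exact: le_trans (ltW r0) rx.
- apply: continuous_subspace_itv => x; rewrite in_itv/= andbT => rx.
  have x_neq0 : x != 0 by rewrite gt_eqF// (lt_le_trans r0).
  apply: cvgM; first exact: cvg_cst.
  apply: (@cvg_comp _ _ _ (fun x : R => x^-1) (fun y : R => y ^+ n.+2) _ (nbhs x^-1)).
    exact: inv_continuous.
  exact: exprn_continuous.
- rewrite -[X in _ --> X]oppr0; apply: cvgN.
  rewrite -[X in _ --> X](expr0n _ n.+1).
  apply: (@cvg_comp _ _ _ (fun x : R => x^-1) (fun y : R => y ^+ n.+1) _ (nbhs 0)).
    by apply/gtr0_cvgV0 => //; exact: nbhs_pinfty_gt.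
  exact: exprn_continuous.
- by move=> x rx; have := dF _ (lt_trans r0 rx).
- apply: cvg_at_right_filter.
  have := dF _ r0 => -[dFr _].
  by apply: differentiable_continuous; exact/derivable1_diffP.
- move=> x; rewrite in_itv/= andbT => rx.
  by rewrite derive1E; have := dF _ (lt_trans r0 rx) => -[_ ->].
Qed.

(* The variable [e] stands for a sign and selects one of the two half-lines. *)
Lemma integral_exprV_half_line n (e r : R) : `|e| = 1 -> 0 < r ->
  (\int[lebesgue_measure]_s
     (((0 < e * s) && (r <= `|s|))%:R * (n.+1%:R * `|s|^-1 ^+ n.+2))%:E =
   (r^-1 ^+ n.+1)%:E)%E.
Proof.
move=> e1 r0.
pose g (s : measurableTypeR R) : \bar R :=
  (((0 < s) && (r <= `|s|))%:R * (n.+1%:R * `|s|^-1 ^+ n.+2))%:E.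
have e0 : e != 0 by rewrite -normr_gt0 e1.
have mg : measurable_fun setT g.
  apply/measurable_EFinP; apply: measurable_funM.
    apply: measurable_fun_natb; apply: measurable_and.
      exact: measurable_fun_ltr.
    exact: measurable_fun_ler.
  by apply: measurable_funM => //; exact: measurable_fun_invX.
(* As |e| = 1, the substitution s -> e s has Jacobian 1 and keeps |s|, so only the positive
   half-line remains to be treated. *)
transitivity (\int[lebesgue_measure]_s g (e * s)%R)%E.
  by apply: eq_integral => s _; rewrite /g normrM e1 mul1r.
rewrite ge0_integral_scale//; last first.
  by move=> x; rewrite lee_fin mulr_ge0// mulr_ge0// exprn_ge0// invr_ge0.
rewrite e1 invr1 mul1e -(@integral_exprV_itvcy n r)// [RHS]integral_mkcond.
apply: eq_integral => s _; rewrite patchE /g.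
case: ifPn => [|]; rewrite ?inE ?notin_setE/= in_itv/= andbT.
  move=> rs; have s0 := lt_le_trans r0 rs.
  by rewrite (gtr0_norm s0) rs s0 mul1r.
move=> /negP; rewrite -ltNge => sr.
case: ltrP => s0; last by rewrite mul0r.
by rewrite gtr0_norm// leNgt sr mul0r.
Qed.

End radial_integrals.

(** * Polar coordinates, with the radius on one half-line *)

Section polar_coordinates.
Context (R : realType).

Lemma measurable_sphere d : measurable (sphere R d).
Proof.
rewrite (_ : sphere R d = eucl_norm @^-1` [set 1])//.
by rewrite -[X in measurable X]setTI; exact: measurable_eucl_norm.
Qed.

(** This is the cone over the whole sphere, the region whose volume defines the surface measure;
    without the origin, x/|x| always lies on the sphere. *)
Definition punctured_ball d : set (Rvec R d) := [set x | 0 < eucl_norm x <= 1].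
Arguments punctured_ball d : clear implicits.

Lemma measurable_punctured_ball d : measurable (punctured_ball d).
Proof.
rewrite (_ : punctured_ball d = eucl_norm @^-1` `]0, 1]); last first.
  by apply/seteqP; split => x /=; rewrite in_itv.
by rewrite -[X in measurable X]setTI; exact: measurable_eucl_norm.
Qed.

Lemma measurable_scalev_fun d (g : Rvec R d -> R) : measurable_fun setT g ->
  measurable_fun setT (fun x => scalev (g x) x).
Proof.
move=> mg.
by move: (measurableT_comp (@measurable_scalev R d)
  (measurable_fun_pair mg (@measurable_id _ _ setT))).
Qed.

(** The surface measure is d times the image, under x -> x/|x|, of Lebesgue measure restricted to
    the punctured ball. *)
Lemma ge0_integral_sphere d (g : Rvec R d -> \bar R) :
  measurable_fun setT g -> (forall x, 0 <= g x)%E ->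
  (\int[sphere_measure R d]_(w in sphere R d) g w =
   d%:R%:E * \int[lebesgue_measure_Rn R d]_(x in punctured_ball d)
               g (scalev (eucl_norm x)^-1 x))%E.
Proof.
move=> mg g0.
have mphi : measurable_fun setT (fun x : Rvec R d => scalev (eucl_norm x)^-1 x).
  apply: measurable_scalev_fun.
  apply: (measurableT_comp (@measurable_invr R)); exact: measurable_eucl_norm.
pose phi : {mfun Rvec R d >-> Rvec R d} :=
  HB.pack (fun x : Rvec R d => scalev (eucl_norm x)^-1 x)
    (isMeasurableFun.Build _ _ _ _ _ mphi).
pose mu := mrestr (lebesgue_measure_Rn R d) (@measurable_punctured_ball d).
rewrite (@eq_measure_integral _ _ _ _ (mscale d%:R%:nng (pushforward mu phi))); last first.
  move=> A mA _ /=; rewrite /sphere_measure /mscale/= /pushforward /mu/= /mrestr.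
  congr (_ * lebesgue_measure_Rn R d _)%E.
  by apply/seteqP; split => x [].
have mS := @measurable_sphere d.
have mgS : measurable_fun (sphere R d) g by apply: (measurable_funS _ _ mg).
rewrite ge0_integral_mscale//.
congr (_ * _)%E.
rewrite ge0_integral_pushforward//.
have mB := @measurable_punctured_ball d.
have mBC : measurable (~` punctured_ball d) by exact: measurableC.
have mphiS : measurable (phi @^-1` sphere R d).
  by rewrite -[X in measurable X]setTI; exact: (mphi measurableT).
have mgphi : measurable_fun (phi @^-1` sphere R d) (g \o phi).
  by apply: (measurable_funS _ _ (measurableT_comp mg mphi)).
have muBC : mu (~` punctured_ball d) = 0%E by rewrite /mu /mrestr setICl measure0.
rewrite (ge0_negligible_integral mBC)//; last by move=> x _; exact: g0.
rewrite setDE setCK (_ : _ `&` _ = punctured_ball d); last first.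
  apply/seteqP; split => x //=; first by case.
  move=> Bx; split => //; case/andP: Bx => x0 _.
  rewrite /sphere/= eucl_norm_scalev ger0_norm ?invr_ge0 ?eucl_norm_ge0//.
  by rewrite mulVf ?gt_eqF.
apply: eq_measure_integral => A mA AB.
by rewrite /= /mu /mrestr setIidl.
Qed.

Lemma measurable_half_line d (T : measurableType d) (e : R) (g : T -> R) :
  measurable_fun setT g -> measurable_fun setT (fun x => (0 < e * g x)%R%:R : R).
Proof.
move=> mg; apply: measurable_fun_natb; apply: measurable_fun_ltr => //.
exact: measurable_funM.
Qed.

Lemma measurable_scalev_swap d : measurable_fun setT
  (fun p : Rvec R d * measurableTypeR R => scalev p.2 p.1).
Proof.
by move: (measurableT_comp (@measurable_scalev R d)
  (measurable_fun_pair (@measurable_snd _ _ (Rvec R d) (measurableTypeR R))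
                       (@measurable_fst _ _ (Rvec R d) (measurableTypeR R)))).
Qed.

Lemma measurable_polar d n (e : R) (f : Rvec R d -> R) :
  measurable_fun setT f ->
  measurable_fun setT (fun p : Rvec R d * measurableTypeR R =>
    ((0 < e * p.2)%R%:R * (`|p.2| ^+ n * f (scalev p.2 p.1)))%:E).
Proof.
move=> mf; apply/measurable_EFinP.
apply: measurable_funM; first exact: measurable_half_line.
apply: measurable_funM.
  by apply: measurable_funX; exact: measurableT_comp.
exact: (measurableT_comp mf (@measurable_scalev_swap d)).
Qed.

(* Since the surface measure is the cone measure, both sides become integrals
   over [x] and over a scaling factor [s]; the change of variables
   [y = s x] and Tonelli's theorem then leave, for each [y], the integral of
   [(n + 1) |s|^-(n + 2)] over [|s| >= |y|], which is [|y|^-(n + 1)]. *)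
Theorem ge0_polar_coordinates n (e : R) (f : Rvec R n.+1 -> R) : `|e| = 1 ->
  measurable_fun setT f -> (forall x, 0 <= f x) ->
  (\int[sphere_measure R n.+1]_(w in sphere R n.+1)
     \int[lebesgue_measure]_nu
       ((0 < e * nu)%R%:R * (`|nu| ^+ n * f (scalev nu w)))%:E =
   \int[lebesgue_measure_Rn R n.+1]_x (f x)%:E)%E.
Proof.
move=> e1 mf f0.
have m_ball d (T : measurableType d) (g h : T -> R) : measurable_fun setT g ->
    measurable_fun setT h ->
    measurable_fun setT (fun x => (0 < g x <= h x)%R%:R : R).
  move=> mg mh; apply: measurable_fun_natb; apply: measurable_and.
    exact: measurable_fun_ltr.
  exact: measurable_fun_ler.
have m_norm := @measurable_eucl_norm R n.+1.
pose F (p : Rvec R n.+1 * measurableTypeR R) :=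
  ((0 < e * p.2)%R%:R * (`|p.2| ^+ n * f (scalev p.2 p.1)))%:E.
have F0 p : (0 <= F p)%E by rewrite lee_fin !mulr_ge0.
have mF : measurable_fun setT F by exact: measurable_polar.
have mFs : measurable_fun setT (fun w => \int[lebesgue_measure]_nu F (w, nu))%E.
  exact: (measurable_fun_fubini_tonelli_F F).
rewrite (ge0_integral_sphere mFs); last by move=> w; apply: integral_ge0.
(* Integrand after nu = |x| s in the inner integral: the direction x/|x| scaled by nu becomes s x,
   while |nu|^n and the Jacobian |x| together leave |x|^(n+1) |s|^n. *)
pose G (p : Rvec R n.+1 * measurableTypeR R) :=
  ((0 < eucl_norm p.1 <= 1)%R%:R * (eucl_norm p.1 ^+ n.+1 *
   ((0 < e * p.2)%R%:R * (`|p.2| ^+ n * f (scalev p.2 p.1)))))%:E.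
have G0 p : (0 <= G p)%E.
  by rewrite lee_fin !mulr_ge0// exprn_ge0// eucl_norm_ge0.
have mn1 : measurable_fun setT
    (fun p : Rvec R n.+1 * measurableTypeR R => eucl_norm p.1).
  exact: measurableT_comp.
have mG : measurable_fun setT G.
  apply/measurable_EFinP; apply: measurable_funM; first exact: m_ball.
  by apply: measurable_funM; [exact: measurable_funX|exact/measurable_EFinP].
transitivity (n.+1%:R%:E * \int[lebesgue_measure_Rn R n.+1]_x
    \int[lebesgue_measure]_s G (x, s))%E.
  congr (_ * _)%E; rewrite [LHS]integral_mkcond; apply: eq_integral => x _.
  rewrite patchE; case: ifPn => [|]; rewrite ?inE ?notin_setE /punctured_ball/=; last first.
    move=> /negP/negbTE xB; rewrite -[LHS](@integral0 _ _ _ lebesgue_measure setT).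
    by apply: eq_integral => s _; rewrite /G/= xB mul0r.
  move=> xB; have /andP[x0 _] := xB.
  have x_neq0 : eucl_norm x != 0 by rewrite gt_eqF.
  pose c := eucl_norm x.
  have mFx : measurable_fun setT (fun nu => F (scalev c^-1 x, nu)).
    exact: (measurable_fun_pair2 _ mF).
  have := ge0_integral_scale x_neq0 mFx (fun _ => F0 _).
  rewrite ger0_norm ?eucl_norm_ge0// => /(congr1 (fun z => (c%:E * z)%E)).
  rewrite muleA -EFinM mulfV// mul1e => <-.
  rewrite -ge0_integralZl//; last 2 first.
  - by apply: measurableT_comp mFx _; exact: mulrl_measurable.
  - by rewrite lee_fin eucl_norm_ge0.
  apply: eq_integral => s _; rewrite /G /F/= xB mul1r -EFinM; congr EFin.
  rewrite scalevA mulrAC mulfV// mul1r normrM (ger0_norm (eucl_norm_ge0 x)).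
  rewrite (mulrCA e) pmulr_rgt0// exprMn exprS -/c; ring.
(* Integrand after y = s x: the ball becomes 0 < |y| <= |s|, and |s|^n, the Jacobian |s|^-(n+1) and
   |x|^(n+1) = |y|^(n+1) |s|^-(n+1) combine into |s|^-(n+2) |y|^(n+1). *)
pose H (p : Rvec R n.+1 * measurableTypeR R) :=
  ((0 < eucl_norm p.1 <= `|p.2|)%R%:R * ((0 < e * p.2)%R%:R *
   (`|p.2|^-1 ^+ n.+2 * (eucl_norm p.1 ^+ n.+1 * f p.1))))%:E.
have H0 p : (0 <= H p)%E.
  by rewrite lee_fin;
    do ![exact: eucl_norm_ge0|apply: exprn_ge0|apply: mulr_ge0|rewrite invr_ge0].
have mH : measurable_fun setT H.
  apply/measurable_EFinP; apply: measurable_funM.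
    by apply: m_ball => //; exact: measurableT_comp.
  apply: measurable_funM; first exact: measurable_half_line.
  apply: measurable_funM.
    by apply: measurable_fun_invX; exact: measurableT_comp.
  apply: measurable_funM; first exact: measurable_funX.
  exact: measurableT_comp.
rewrite (fubini_tonelli G)//.
transitivity (n.+1%:R%:E * \int[lebesgue_measure]_s
    \int[lebesgue_measure_Rn R n.+1]_y H (y, s))%E.
  congr (_ * _)%E; apply: eq_integral => s _.
  (* The substitution is impossible for s = 0, but there the cutoff 0 < e s kills both
     integrands. *)
  have [->|s0] := eqVneq s 0.
    apply: eq_integral => x _; rewrite /G /H/= mulr0 ltxx.
    by rewrite !mul0r !mulr0.
  have mHs : measurable_fun setT (fun y => H (y, s)).
    exact: (measurable_fun_pair1 _ mH).
  have := ge0_integral_Rn_scale s0 mHs (fun _ => H0 _).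
  move=> /(congr1 (fun z => ((`|s| ^+ n.+1)%:E * z)%E)).
  rewrite muleA -EFinM mulfV ?expf_neq0 ?normr_eq0// mul1e => <-.
  rewrite -ge0_integralZl//;
    last by move: (measurableT_comp mHs (measurable_scalevr s)).
  apply: eq_integral => x _; rewrite /G /H/= -EFinM; congr EFin.
  have s_gt0 : 0 < `|s| by rewrite normr_gt0.
  rewrite eucl_norm_scalev (pmulr_rgt0 _ s_gt0) ger_pMr//.
  rewrite exprVn !exprMn !exprS; field.
  by rewrite normr_eq0 s0 expf_neq0 ?normr_eq0.
rewrite -(fubini_tonelli H)//.
have mHy : measurable_fun setT (fun y => \int[lebesgue_measure]_s H (y, s))%E.
  exact: (measurable_fun_fubini_tonelli_F H).
rewrite -ge0_integralZl//; last by move=> x _; exact: integral_ge0.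
have mf' : measurable_fun setT (fun y => (f y)%:E) by exact/measurable_EFinP.
apply: ge0_ae_eq_integral => //.
- by apply: emeasurable_funM.
- by move=> x _; rewrite mule_ge0// integral_ge0.
- by move=> x _; rewrite lee_fin.
(* At y = 0 the cutoff makes [H] vanish whatever the value of [f], so the two integrands are
   compared off the origin. *)
exists [set x | eucl_norm x = 0]; split.
- rewrite (_ : [set _ | _] = eucl_norm @^-1` [set 0])//.
  by rewrite -[X in measurable X]setTI; exact: m_norm.
- exact: lebesgue_measure_Rn_norm0.
move=> y /=; apply: contra_notP => /eqP y_neq0 _.
have y0 : 0 < eucl_norm y by rewrite lt_neqAle eq_sym y_neq0 eucl_norm_ge0.
transitivity (\int[lebesgue_measure]_s ((eucl_norm y ^+ n.+1 * f y)%:E *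
    (((0 < e * s) && (eucl_norm y <= `|s|))%:R * (n.+1%:R * `|s|^-1 ^+ n.+2))%:E))%E.
  rewrite -ge0_integralZl//; last exact: (measurable_fun_pair2 _ mH).
  apply: eq_integral => s _; rewrite /H/= -!EFinM y0/= -mulnb natrM; congr EFin.
  ring.
rewrite ge0_integralZl//; last 2 first.
- apply/measurable_EFinP; apply: measurable_funM.
    apply: measurable_fun_natb; apply: measurable_and.
      by apply: measurable_fun_ltr => //; exact: measurable_funM.
    exact: measurable_fun_ler.
  by apply: measurable_funM => //; exact: measurable_fun_invX.
- by rewrite lee_fin mulr_ge0// exprn_ge0// eucl_norm_ge0.
rewrite integral_exprV_half_line// -EFinM; congr EFin.
by rewrite mulrAC -exprMn mulfV// expr1n mul1r.
Qed.

End polar_coordinates.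

(** * Polar coordinates with nu on the whole line *)

Section polar_line.
Context (R : realType) (n : nat).
Implicit Types f fp fm : Rvec R n.+1 -> R.

(** Two functions are needed because the two half-lines carry different densities. The Jacobian
    |nu|^n is built in, and the value at nu = 0 is 0. *)
Definition polar_line fp fm (w : Rvec R n.+1) (nu : measurableTypeR R) : \bar R :=
  ((0 < nu)%R%:R * (`|nu| ^+ n * fp (scalev nu w)) +
   (nu < 0)%R%:R * (`|nu| ^+ n * fm (scalev nu w)))%:E.

Lemma polar_lineE fp fm w nu : polar_line fp fm w nu =
  (((0 < 1 * nu)%R%:R * (`|nu| ^+ n * fp (scalev nu w)))%:E +
   ((0 < -1 * nu)%R%:R * (`|nu| ^+ n * fm (scalev nu w)))%:E)%E.
Proof. by rewrite mul1r mulN1r oppr_gt0. Qed.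

Lemma polar_line_ge0 fp fm w nu : (forall x, 0 <= fp x) ->
  (forall x, 0 <= fm x) -> (0 <= polar_line fp fm w nu)%E.
Proof. by move=> fp0 fm0; rewrite lee_fin addr_ge0// !mulr_ge0. Qed.

Lemma measurable_polar_line fp fm : measurable_fun setT fp ->
  measurable_fun setT fm ->
  measurable_fun setT (fun p => polar_line fp fm p.1 p.2).
Proof.
move=> mfp mfm.
have := emeasurable_funD (measurable_polar n 1 mfp) (measurable_polar n (-1) mfm).
by congr measurable_fun; apply/funext => p /=; rewrite polar_lineE.
Qed.

(** Each half-line, with w running over the sphere, covers the whole space once; the polar formula
    is used with e = 1 and e = -1 and the results are added. *)
Lemma ge0_polar_coordinates_line fp fm :
  measurable_fun setT fp -> measurable_fun setT fm ->
  (forall x, 0 <= fp x) -> (forall x, 0 <= fm x) ->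
  (\int[sphere_measure R n.+1]_(w in sphere R n.+1)
     \int[lebesgue_measure]_nu polar_line fp fm w nu =
   \int[lebesgue_measure_Rn R n.+1]_x (fp x + fm x)%:E)%E.
Proof.
move=> mfp mfm fp0 fm0.
pose g (e : R) f (w : Rvec R n.+1) (nu : measurableTypeR R) : \bar R :=
  ((0 < e * nu)%R%:R * (`|nu| ^+ n * f (scalev nu w)))%:E.
have g0 e f w nu : (forall x, 0 <= f x) -> (0 <= g e f w nu)%E.
  by move=> f0; rewrite lee_fin !mulr_ge0.
have mg e f w : measurable_fun setT f -> measurable_fun setT (g e f w).
  by move=> mf; move: (measurable_fun_pair2 w (measurable_polar n e mf)).
have mintg e f : measurable_fun setT f -> (forall x, 0 <= f x) ->
    measurable_fun (sphere R n.+1) (fun w => \int[lebesgue_measure]_nu g e f w nu)%E.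
  move=> mf f0; apply: (measurable_funS measurableT) => //.
  apply: (measurable_fun_fubini_tonelli_F (fun p => g e f p.1 p.2)).
    exact: measurable_polar.
  by move=> p; exact: g0.
have mS := @measurable_sphere R n.+1.
transitivity (\int[sphere_measure R n.+1]_(w in sphere R n.+1)
   (\int[lebesgue_measure]_nu g 1%R fp w nu +
    \int[lebesgue_measure]_nu g (-1)%R fm w nu))%E.
  apply: eq_integral => w _; rewrite -ge0_integralD//; last 4 first.
  - by move=> x _; exact: g0.
  - exact: mg.
  - by move=> x _; exact: g0.
  - exact: mg.
  by apply: eq_integral => nu _; rewrite polar_lineE.
rewrite ge0_integralD//; last 4 first.
- by move=> w _; apply: integral_ge0 => nu _; exact: g0.
- exact: mintg.
- by move=> w _; apply: integral_ge0 => nu _; exact: g0.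
- exact: mintg.
rewrite (ge0_polar_coordinates (normr1 R) mfp fp0).
rewrite (ge0_polar_coordinates (normrN1 R) mfm fm0).
rewrite -ge0_integralD//.
- by move=> x _; rewrite lee_fin.
- exact/measurable_EFinP.
- by move=> x _; rewrite lee_fin.
- exact/measurable_EFinP.
Qed.

(** Let the exceptions lie in a null set [N]. The polar integral of its indicator is 0, so the inner
    integral vanishes for almost every w, and then the integrand vanishes for almost every nu. *)
Lemma ae_polar_line (P : Rvec R n.+1 -> Prop) :
  {ae lebesgue_measure_Rn R n.+1, forall x, P x} ->
  {ae sphere_measure R n.+1, forall w, sphere R n.+1 w ->
    {ae lebesgue_measure, forall nu : measurableTypeR R, P (scalev nu w)}}.
Proof.
move=> [N [mN N0 PN]]; pose f : Rvec R n.+1 -> R := \1_N.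
have mf : measurable_fun setT f by exact: measurable_indic.
have f0 x : 0 <= f x by [].
have h0 w nu : (0 <= polar_line f f w nu)%E by exact: polar_line_ge0.
have mh := measurable_polar_line mf mf.
pose g w := (\int[lebesgue_measure]_nu polar_line f f w nu)%E.
have g0 w : (0 <= g w)%E by exact: integral_ge0.
have mg : measurable_fun (sphere R n.+1) g.
  apply: (measurable_funS measurableT) => //.
  by apply: (measurable_fun_fubini_tonelli_F (fun p => polar_line f f p.1 p.2)).
have := ge0_polar_coordinates_line mf mf f0 f0.
rewrite (_ : \int[_]_x _ = 0)%E; last first.
  rewrite -(integral0 (lebesgue_measure_Rn R n.+1) setT).
  apply: ge0_ae_eq_integral => //.
  - by apply/measurable_EFinP; exact: measurable_funD.
  - by move=> x _; rewrite lee_fin addr_ge0.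
  exists N; split => // x /=; apply: contra_notP => xN _.
  by rewrite /f indicE memNset// addr0.
move=> intg0.
have {intg0} : (\int[sphere_measure R n.+1]_(w in sphere R n.+1) `|g w| = 0)%E.
  by rewrite -intg0; apply: eq_integral => w _; rewrite gee0_abs.
move/(ae_eq_integral_abs (sphere_measure R n.+1) (@measurable_sphere R n.+1) mg).
apply: filterS => w /[apply] gw0.
have mhw : measurable_fun setT (polar_line f f w).
  by move: (measurable_fun_pair2 w mh).
have {gw0} : (\int[lebesgue_measure]_nu `|polar_line f f w nu| = 0)%E.
  by rewrite -[RHS]gw0; apply: eq_integral => nu _; rewrite gee0_abs.
move/(ae_eq_integral_abs lebesgue_measure measurableT mhw).
(* At nu = 0 the integrand is 0 in any case and says nothing about [N], so this point is
   discarded. *)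
have nu_neq0 : {ae lebesgue_measure, forall nu : measurableTypeR R, nu <> 0}.
  exists [set 0]; split => //; first exact: lebesgue_measure_set1.
  by move=> nu /= /contrapT.
apply: filterS2 nu_neq0 => nu /eqP nu0 /(_ Logic.I) [hnu].
apply: contrapT => /PN Nnu; move: hnu.
rewrite /f indicE mem_set// mulr1 -mulrDl => /eqP.
rewrite mulf_eq0 expf_eq0 normr_eq0 (negbTE nu0) andbF orbF.
by case: ltgtP nu0 => //; rewrite ?addr0 ?add0r oner_eq0.
Qed.

End polar_line.

(** * Measurability of complex-valued functions *)

Section complex_measurability.
Context (R : realType) d (T : measurableType d).
Implicit Types f g : T -> R[i].

Lemma ReM (x y : R[i]) :
  complex.Re (x * y) = complex.Re x * complex.Re y - complex.Im x * complex.Im y.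
Proof. by case: x y => a b [a' b']. Qed.

Lemma ImM (x y : R[i]) :
  complex.Im (x * y) = complex.Re x * complex.Im y + complex.Im x * complex.Re y.
Proof. by case: x y => a b [a' b']. Qed.

Lemma cmeasurable_funM f g : cmeasurable_fun setT f -> cmeasurable_fun setT g ->
  cmeasurable_fun setT (fun x => f x * g x).
Proof.
move=> [f1 f2] [g1 g2]; split.
  under eq_fun do rewrite ReM.
  by apply: measurable_funB; exact: measurable_funM.
under eq_fun do rewrite ImM.
by apply: measurable_funD; exact: measurable_funM.
Qed.

Lemma cmeasurable_funD f g : cmeasurable_fun setT f -> cmeasurable_fun setT g ->
  cmeasurable_fun setT (fun x => f x + g x).
Proof.
move=> [f1 f2] [g1 g2]; split.
  by under eq_fun do rewrite raddfD/=; exact: measurable_funD.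
by under eq_fun do rewrite raddfD/=; exact: measurable_funD.
Qed.

Lemma cmeasurable_cst (c : R[i]) : cmeasurable_fun setT (fun _ : T => c).
Proof. by split; exact: measurable_cst. Qed.

Lemma cmeasurable_real (f : T -> R) : measurable_fun setT f ->
  cmeasurable_fun setT (fun x => (f x)%:C).
Proof. by split => //=; exact: measurable_cst. Qed.

Lemma cmeasurable_natb (b : T -> bool) : measurable_fun setT b ->
  cmeasurable_fun setT (fun x => (b x)%:R : R[i]).
Proof.
move=> mb; rewrite (_ : (fun _ => _) = (fun x => ((b x)%:R : R)%:C)).
  by apply: cmeasurable_real; exact: measurable_fun_natb.
by apply/funext => x; case: (b x).
Qed.

Lemma measurable_sqmod f : cmeasurable_fun setT f ->
  measurable_fun setT (fun x => sqmod (f x)).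
Proof. by move=> [f1 f2]; apply: measurable_funD; exact: measurable_funX. Qed.

End complex_measurability.

Lemma cmeasurable_comp (R : realType) d1 d2 (T1 : measurableType d1)
    (T2 : measurableType d2) (f : T2 -> R[i]) (g : T1 -> T2) :
  cmeasurable_fun setT f -> measurable_fun setT g ->
  cmeasurable_fun setT (fun x => f (g x)).
Proof.
move=> [f1 f2] mg.
by split; [exact: (measurableT_comp f1 mg)|exact: (measurableT_comp f2 mg)].
Qed.

(** * Squared moduli and the parallelogram identity *)

Section sqmod.
Context (R : realType).
Implicit Types z w : R[i].

Lemma sqmod_ge0 z : 0 <= sqmod z.
Proof. by rewrite addr_ge0 ?sqr_ge0. Qed.

Lemma sqmodM z w : sqmod (z * w) = sqmod z * sqmod w.
Proof. by rewrite /sqmod ReM ImM; ring. Qed.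

Lemma sqmod_real (a : R) : sqmod a%:C = a ^+ 2.
Proof. by rewrite /sqmod/= expr0n addr0. Qed.

Lemma sqmod_cis (t : R) : sqmod (cis t) = 1.
Proof. exact: cos2Dsin2. Qed.

(** For nu different from 0 exactly one of the two cutoffs is 1; at 0 both vanish and so does the
    phase. *)
Lemma sqmod_phase d (nu : R) : nu != 0 -> sqmod (phase d nu) = 1.
Proof.
rewrite /phase; case: ltgtP => // _ _.
  by rewrite mulr1 mulr0 addr0 sqmod_cis.
by rewrite mulr1 mulr0 add0r sqmod_cis.
Qed.

(** Here c = 1 or c = -1 is the sign with which the second datum enters; the cross terms of the two
    squares cancel. *)
Lemma sqmod_parallelogram (r c : R) z w : c ^+ 2 = 1 ->
  sqmod ((0 +i* r) * z + c%:C * w) + sqmod ((0 +i* (- r)) * z + c%:C * w) =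
  2 * (r ^+ 2 * sqmod z + sqmod w).
Proof.
case: z w => [a b] [a' b'] c2; rewrite /sqmod/=.
rewrite !(mul0r, add0r, sub0r, subr0, addr0).
transitivity (2 * (r ^+ 2 * (a ^+ 2 + b ^+ 2) + c ^+ 2 * (a' ^+ 2 + b' ^+ 2))).
  by ring.
by rewrite c2 mul1r.
Qed.

End sqmod.

(** With d = n + 1, this turns the squared factor |nu|^((d-1)/2) of the multiplier into the polar
    Jacobian |nu|^n; it also serves to compute the square of [c_d]. *)
Lemma powR_half_sqr (R : realType) n (r : R) : 0 <= r ->
  (r `^ ((n.+1%:R - 1) / 2)) ^+ 2 = r ^+ n.
Proof.
move=> r0; rewrite -[RHS]powR_mulrn// -[LHS]powR_mulrn ?powR_ge0// -powRrM.
by congr (_ `^ _); rewrite -natr1; field.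
Qed.

(** * The isometry property for a general multiplier of the right modulus *)

Section multiplier.
Context (R : realType) (n : nat) (beta c : R) (m : measurableTypeR R -> R[i]).
Let d := n.+1.
Hypothesis c2 : c ^+ 2 = 1.
Hypothesis cmeas_m : cmeasurable_fun setT m.
Hypothesis sqmod_m : forall nu, nu != 0 ->
  sqmod (m nu) = 2 * c_d R d ^+ 2 * `|nu| ^+ n.

(** Common form of both normalised maps: [c] is the sign of the second datum, and the factor sqrt 2
    is part of [m], whence the 2 in [sqmod_m]. *)
Let T (u : data R d) : profile R d := fun p =>
  m p.1 * ((0 +i* p.1) * u.1 (scalev p.1 p.2) + c%:C * u.2 (scalev p.1 p.2)).

(** For s = 1 or s = -1, this is the integrand of the profile norm on the half-line of sign s as a
    function of x = nu w, where nu = s |x|. The factor |nu|^n is left out, since [polar_line]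
    supplies it. *)
Let density (s : R) (u : data R d) (x : Rvec R d) : R :=
  2 * c_d R d ^+ 2 * (eucl_norm x `^ (2 * (beta - 1)) *
    sqmod ((0 +i* (s * eucl_norm x)) * u.1 x + c%:C * u.2 x)).

Let in_data_meas (u : data R d) : in_data beta u ->
  cmeasurable_fun setT u.1 /\ cmeasurable_fun setT u.2.
Proof. by move=> [[? _] [? _]]. Qed.

Let cmeasurable_T u : in_data beta u -> cmeasurable_fun setT (T u).
Proof.
move=> /in_data_meas[mu1 mu2].
have ms : measurable_fun setT
  (fun p : measurableTypeR R * Rvec R d => scalev p.1 p.2).
  exact: measurable_scalev.
apply: cmeasurable_funM.
  exact: (cmeasurable_comp cmeas_m (@measurable_fst _ _ _ _)).
apply: cmeasurable_funD.
  apply: cmeasurable_funM; last exact: cmeasurable_comp.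
  by split => /=; [exact: measurable_cst|exact: measurable_fst].
by apply: cmeasurable_funM; [exact: cmeasurable_cst|exact: cmeasurable_comp].
Qed.

Let measurable_norm_powR (p : R) :
  measurable_fun setT (fun x : Rvec R d => eucl_norm x `^ p).
Proof.
apply: (measurableT_comp (f := @powR R ^~ p)); first exact: measurable_powR.
exact: measurable_eucl_norm.
Qed.

Let density_ge0 s u x : 0 <= density s u x.
Proof.
by apply: mulr_ge0; rewrite mulr_ge0 ?sqr_ge0 ?powR_ge0 ?sqmod_ge0.
Qed.

Let measurable_density s u : in_data beta u -> measurable_fun setT (density s u).
Proof.
move=> /in_data_meas[mu1 mu2].
apply: measurable_funM => //; apply: measurable_funM => //.
apply: measurable_sqmod; apply: cmeasurable_funD.
  apply: cmeasurable_funM => //; split => /=; first exact: measurable_cst.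
  by apply: measurable_funM; [exact: measurable_cst|exact: measurable_eucl_norm].
by apply: cmeasurable_funM => //; exact: cmeasurable_cst.
Qed.

Let hdot1_sqnorm_T u w : in_data beta u -> sphere R d w ->
  hdot1_sqnorm (beta - 1) (fun nu => T u (nu, w)) =
  (((2 * pi)^-1)%:E * \int[lebesgue_measure]_nu
    polar_line (density 1 u) (density (-1) u) w nu)%E.
Proof.
move=> du w1; congr (_ * _)%E.
have mu1 := measurable_density 1 du; have mu2 := measurable_density (-1) du.
apply: ge0_ae_eq_integral => //.
- apply/measurable_EFinP; apply: measurable_funM.
    by apply: (measurableT_comp (f := @powR R ^~ _)); [exact: measurable_powR|].
  apply: measurable_sqmod.
  by apply: (cmeasurable_comp (cmeasurable_T du)); exact: measurable_fun_pair.
- by move: (measurable_fun_pair2 w (measurable_polar_line mu1 mu2)).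
- by move=> nu _; rewrite lee_fin mulr_ge0 ?powR_ge0 ?sqmod_ge0.
- by move=> nu _; apply: polar_line_ge0 => x; exact: density_ge0.
(* The modulus of [m] is prescribed only for nu different from 0; elsewhere |w| = 1 gives |nu w| =
   |nu|, and the integrands agree. *)
exists [set 0]; split => //; first exact: lebesgue_measure_set1.
move=> nu /=; apply: contra_notP => /eqP nu0 _.
rewrite /polar_line /T /density/= sqmodM sqmod_m// eucl_norm_scalev w1 !mulr1.
case: ltgtP nu0 => // nu0 _; congr EFin.
- by rewrite gtr0_norm// mul1r mul0r mul1r addr0; ring.
- by rewrite ltr0_norm// mulN1r opprK mul0r mul1r add0r; ring.
Qed.

Let c_d_sq : c_d R d ^+ 2 = (4 * (2 * pi) ^+ n)^-1.
Proof.
rewrite /c_d /d div1r exprVn exprMn powR_half_sqr ?mulr_ge0 ?pi_ge0//.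
by rewrite -natrX.
Qed.

(** The factor |xi|^2 from the symbol i nu raises the weight from order beta - 1 to order beta. At r
    = 0 this can fail: for beta = 0 the right side is 1 and the left side 0. *)
Let powR_sqr (r : R) : 0 < r -> r `^ (2 * (beta - 1)) * r ^+ 2 = r `^ (2 * beta).
Proof.
move=> r0; rewrite -powR_mulrn ?ltW// -powRD; last by rewrite (gt_eqF r0) implybT.
by congr (_ `^ _); ring.
Qed.

(** The constants match: the 2 from sqrt 2 and the 2 from the parallelogram identity cancel the 4 in
    [c_d_sq], and (2 pi)^-1 (2 pi)^-n = (2 pi)^-d. *)
Let profile_sqnorm_T u : in_data beta u ->
  profile_sqnorm (beta - 1) (T u) =
  (hdot_sqnorm beta u.1 + hdot_sqnorm (beta - 1) u.2)%E.
Proof.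
move=> du; have [mu1 mu2] := in_data_meas du.
have md1 := measurable_density 1 du; have md2 := measurable_density (-1) du.
have p0 : (0 : R) < 2 * pi by rewrite mulr_gt0// pi_gt0.
rewrite /profile_sqnorm.
transitivity (\int[sphere_measure R d]_(w in sphere R d)
    (((2 * pi)^-1)%:E * \int[lebesgue_measure]_nu
       polar_line (density 1 u) (density (-1) u) w nu))%E.
  by apply: eq_integral => w /[!inE] Sw; rewrite hdot1_sqnorm_T.
rewrite ge0_integralZl//; last 4 first.
- exact: measurable_sphere.
- apply: (measurable_funS measurableT) => //.
  apply: (measurable_fun_fubini_tonelli_F
    (fun p => polar_line (density 1 u) (density (-1) u) p.1 p.2)).
    exact: measurable_polar_line.
  by move=> p; exact: polar_line_ge0.
- by move=> w _; apply: integral_ge0 => nu _; exact: polar_line_ge0.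
- by rewrite lee_fin invr_ge0 ltW.
rewrite ge0_polar_coordinates_line//.
have m_sq (a : R) (f : Rvec R d -> R[i]) : cmeasurable_fun setT f ->
    measurable_fun setT (fun x => (eucl_norm x `^ a * sqmod (f x))%:E).
  move=> mf; apply/measurable_EFinP; apply: measurable_funM => //.
  exact: measurable_sqmod.
have sq0 (a : R) (f : Rvec R d -> R[i]) x :
    (0 <= (eucl_norm x `^ a * sqmod (f x))%:E)%E.
  by rewrite lee_fin mulr_ge0 ?powR_ge0 ?sqmod_ge0.
rewrite /hdot_sqnorm -ge0_muleDr ?integral_ge0//.
rewrite -ge0_integralD//; last 2 first.
- exact: m_sq.
- exact: m_sq.
rewrite -!ge0_integralZl//; last 6 first.
- by apply: emeasurable_funD; exact: m_sq.
- by move=> x _; rewrite adde_ge0.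
- by rewrite lee_fin invr_ge0 exprn_ge0 ?ltW.
- by apply/measurable_EFinP; exact: measurable_funD.
- by move=> x _; rewrite lee_fin addr_ge0.
- by rewrite lee_fin invr_ge0 ltW.
apply: ge0_ae_eq_integral => //.
- apply: emeasurable_funM => //; apply/measurable_EFinP; exact: measurable_funD.
- by apply: emeasurable_funM => //; apply: emeasurable_funD; exact: m_sq.
- by move=> x _; rewrite mule_ge0// lee_fin ?addr_ge0// invr_ge0 ltW.
- by move=> x _; rewrite mule_ge0// ?adde_ge0// lee_fin invr_ge0 exprn_ge0// ltW.
exists [set x | eucl_norm x = 0]; split.
- rewrite (_ : [set _ | _] = eucl_norm @^-1` [set 0])//.
  by rewrite -[X in measurable X]setTI; exact: measurable_eucl_norm.
- exact: lebesgue_measure_Rn_norm0.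
move=> x /=; apply: contra_notP => /eqP x_neq0 _.
have x0 : 0 < eucl_norm x by rewrite lt_neqAle eq_sym x_neq0 eucl_norm_ge0.
rewrite -EFinD -!EFinM; congr EFin.
rewrite /density -mulrDr -mulrDr mul1r mulN1r sqmod_parallelogram// c_d_sq.
rewrite -(powR_sqr x0) /d (exprS (2 * pi) n).
move: (2 * pi) p0 => q q0; field.
by rewrite expf_neq0 gt_eqF.
Qed.

(** Finiteness and equality of norms both follow from [profile_sqnorm_T]. Almost everywhere equality
    passes to profiles by [ae_polar_line], and linearity holds pointwise. *)
Lemma multiplier_isometry : is_isometry beta T.
Proof.
split.
- move=> u du; split.
    have [mT1 mT2] := cmeasurable_T du.
    have mD : measurable (setT `*` sphere R d : set (measurableTypeR R * Rvec R d)).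
      by apply: measurableX => //; exact: measurable_sphere.
    by split; apply: (measurable_funS measurableT).
  rewrite profile_sqnorm_T// lte_add_pinfty//; by case: du => -[_ ?] [_ ?].
- move=> u v _ _ [uv1 uv2].
  have uv : {ae lebesgue_measure_Rn R d, forall x, u.1 x = v.1 x /\ u.2 x = v.2 x}.
    by apply: filterS2 uv1 uv2 => x.
  apply: filterS (ae_polar_line uv) => w /[apply].
  by apply: filterS => nu [e1 e2]; rewrite /T/= e1 e2.
- move=> a u v _ _; apply: aeW => w _; apply: aeW => nu.
  by rewrite /T/=; ring.
- by move=> u du; rewrite /profile_norm /data_norm profile_sqnorm_T.
Qed.

End multiplier.

(** * The multiplier of the radiation profile maps *)

Section radiation_multiplier.
Context (R : realType) (n : nat).

(* The factor common to [Tplus] and [Tminus]. *)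
Definition radiation_multiplier (nu : measurableTypeR R) : R[i] :=
  (Num.sqrt 2)%:C *
  ((c_d R n.+1 * `|nu| `^ ((n.+1%:R - 1) / 2))%:C * phase n.+1 nu).

Lemma cmeasurable_radiation_multiplier :
  cmeasurable_fun setT radiation_multiplier.
Proof.
apply: cmeasurable_funM; first exact: cmeasurable_cst.
apply: cmeasurable_funM.
  apply: cmeasurable_real; apply: measurable_funM; first exact: measurable_cst.
  by apply: (measurableT_comp (f := @powR R ^~ _)); [exact: measurable_powR|].
apply: cmeasurable_funD; apply: cmeasurable_funM.
- exact: cmeasurable_cst.
- by apply: cmeasurable_natb; exact: measurable_fun_ltr.
- exact: cmeasurable_cst.
- by apply: cmeasurable_natb; exact: measurable_fun_ltr.
Qed.

Lemma sqmod_radiation_multiplier nu : nu != 0 ->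
  sqmod (radiation_multiplier nu) = 2 * c_d R n.+1 ^+ 2 * `|nu| ^+ n.
Proof.
move=> nu0; rewrite !sqmodM !sqmod_real sqmod_phase// mulr1.
by rewrite sqr_sqrtr// exprMn powR_half_sqr// mulrA.
Qed.

End radiation_multiplier.

Theorem proposition1p2 (R : realType) (d : nat) (beta : R) (hd : (3 <= d)%N) :
  is_isometry beta (fun (u : data R d) p => (Num.sqrt 2)%:C * Tplus u p) /\
  is_isometry beta (fun (u : data R d) p => (Num.sqrt 2)%:C * Tminus u p).
Proof.
case: d hd => [//|n] _.
have cm := @cmeasurable_radiation_multiplier R n.
have sm := @sqmod_radiation_multiplier R n.
split.
(* For [Tplus] the leading minus sign goes into the multiplier, and the minus sign before the second
   datum becomes c = -1. *)
- have cmN : cmeasurable_fun setT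
      (fun nu : measurableTypeR R => -1 * radiation_multiplier n nu).
    by apply: cmeasurable_funM => //; exact: cmeasurable_cst.
  have smN (nu : R) : nu != 0 -> sqmod (-1 * radiation_multiplier n nu) =
      2 * c_d R n.+1 ^+ 2 * `|nu| ^+ n.
    move=> nu0; rewrite sqmodM -sm// /sqmod/= oppr0 expr0n addr0.
    by rewrite sqrrN expr1n mul1r.
  have N12 : (-1 : R) ^+ 2 = 1 by rewrite sqrrN expr1n.
  have := multiplier_isometry beta N12 cmN smN.
  congr is_isometry; apply/funext => u; apply/funext => -[nu w].
  rewrite /Tplus /radiation_multiplier /= rmorphN1; ring.
(* For [Tminus] the multiplier is taken as it is, with c = 1. *)
- have := multiplier_isometry beta (expr1n R 2) cm sm.
  congr is_isometry; apply/funext => u; apply/funext => -[nu w].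
  rewrite /Tminus /radiation_multiplier /= rmorph1; ring.
Qed.
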